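(* Let $r \ge 2$ and $n \ge 1$ be integers. There is a bijection $\Phi$ from $\mathrm{Reg}_r(rn)$ to $\mathrm{Cyc}^*_r(rn)$ with the following property: whenever $\sigma \in \mathrm{Reg}_r(rn)$ and the cycle containing $1$ in $\sigma$ has length $rk+i$ with integers $k\ge 0$ and $1 \le i \le r-1$, the cycle containing $1$ in the underlying permutation of $\Phi(\sigma)$ has length $rk+r$.
   Context: Permutations of $[N]=\{1,\dots,N\}$ are viewed through their disjoint cycle decompositions, fixed points counting as cycles of length $1$. For $r\ge 2$, a cycle is $r$-regular if its length is not divisible by $r$, and $r$-singular if its length is divisible by $r$. $\mathrm{Reg}_r(N)$ is the set of $r$-regular permutations of $[N]$, i.e. those all of whose cycles are $r$-regular. An $r$-cycle permutation is a permutation all of whose cycles are $r$-singular. An enriched ($r$-enriched) permutation is a permutation together with an assignment, to each of its $r$-singular cycles, of one of the $r-1$ colors in $\{1,2,\dots,r-1\}$ ($r$-regular cycles are not colored; different cycles may receive the same color). $\mathrm{Cyc}^*_r(N)$ is the set of enriched $r$-cycle permutations of $[N]$, i.e. permutations of $[N]$ all of whose cycles have length divisible by $r$, with each cycle assigned a color from $\{1,\dots,r-1\}$. *)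

(* Defs.v *)
From mathcomp Require Import all_boot all_fingroup.

Set Implicit Arguments.
Unset Strict Implicit.
Unset Printing Implicit Defensive.

(* [N] is 'I_N, with the ordinal j standing for j + 1.  The cycles of s, fixed
   points included, are represented by their supports, the elements of
   porbits s; the length of a cycle C is #|C|. *)

Definition cycle_regular (r N : nat) (C : {set 'I_N}) : bool := ~~ (r %| #|C|).

Definition cycle_singular (r N : nat) (C : {set 'I_N}) : bool := r %| #|C|.

Definition perm_regular (r N : nat) (s : 'S_N) : bool :=
  [forall C in porbits s, cycle_regular r C].

Definition rcycle_perm (r N : nat) (s : 'S_N) : bool :=
  [forall C in porbits s, cycle_singular r C].

Definition Reg (r N : nat) : Type := {s : 'S_N | perm_regular r s}.

Definition color (r : nat) : Type := {j : 'I_r | 0 < j}.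

Definition singular_cycles (r N : nat) (s : 'S_N) : Type :=
  {C : {set 'I_N} | (C \in porbits s) && cycle_singular r C}.

(* {ffun _ -> _} rather than a plain function type, so that two enriched
   permutations with the same underlying permutation are equal as soon as
   every singular cycle has the same color in both. *)
Definition enriched (r N : nat) : Type :=
  {s : 'S_N & {ffun singular_cycles r s -> color r}}.

Definition underlying (r N : nat) (e : enriched r N) : 'S_N := projT1 e.

Definition CycStar (r N : nat) : Type :=
  {e : enriched r N | rcycle_perm r (underlying e)}.

Lemma muln_gt0_of (r n : nat) : 1 < r -> 0 < n -> 0 < r * n.
Proof. by move=> hr hn; rewrite muln_gt0 hn (ltnW hr). Qed.

(* The element 1 of [rn]. *)
Definition elt1 (r n : nat) (hr : 1 < r) (hn : 0 < n) : 'I_(r * n) :=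
  Ordinal (muln_gt0_of hr hn).

(* Main.v *)
(* The bijection is obtained by counting.  Let d(N) be the product of the
   t - [r | t] for 1 <= t <= N.  Conditioning on the cycle of a given point shows
   that, on N points, there are d(N) regular permutations and [r | N] d(N)
   enriched r-cycle permutations.  With m = n - k - 1, the regular permutations
   of [rn] whose marked cycle has length rk + i number
     (rn-1)(rn-2)...(rn-rk-i+1) d(rm + r - i)
       = (rn-1)(rn-2)...(rm+1) d(rm),
   which does not depend on i.  Summing over the r - 1 values of i gives exactly
   the number of enriched r-cycle permutations whose marked cycle has length
   rk + r, the factor r - 1 being the choice of its color. *)
Require Import Defs.
From mathcomp Require Import all_boot all_fingroup.
From mathcomp Require Import zify.
Set Implicit Arguments.
Unset Strict Implicit.
Unset Printing Implicit Defensive.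

(** * Cycles of a permutation, and cutting a point out of a cycle *)

Lemma mem_porbitS (T : finType) (s : {perm T}) (x z : T) :
  z \in porbit s x -> s z \in porbit s x.
Proof.
by rewrite -!eq_porbit_mem => /eqP<-; rewrite -(porbit_perm s 1 z) expg1.
Qed.

Lemma porbit_sub_stable (T : finType) (s : {perm T}) (x : T) (A : {set T}) :
  x \in A -> {in A, forall z, s z \in A} -> porbit s x \subset A.
Proof.
move=> xA stabA; apply/subsetP=> _ /porbitP[i ->].
by elim: i => [|i IHi]; rewrite ?perm1 // expgSr permM stabA.
Qed.

Lemma porbit_fix (T : finType) (s : {perm T}) (x : T) :
  s x = x -> porbit s x = [set x].
Proof.
move=> sx; apply/eqP; rewrite eqEsubset sub1set porbit_id andbT.
by apply: porbit_sub_stable => [|z /set1P->]; rewrite ?sx set11.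
Qed.

Lemma eq_in_porbit (T : finType) (s t : {perm T}) (x : T) :
  {in porbit s x, s =1 t} -> porbit s x = porbit t x.
Proof.
move=> eq_st; apply/eqP; rewrite eqEsubset; apply/andP; split; last first.
  apply: porbit_sub_stable; first exact: porbit_id.
  by move=> z sz; rewrite -eq_st // mem_porbitS.
(* The two permutations are known to agree only on [porbit s x], so stability under [s] is proved
   for the intersection of the two orbits. *)
suff /subsetP sub: porbit s x \subset porbit s x :&: porbit t x.
  by apply/subsetP=> z /sub /setIP[].
apply: porbit_sub_stable; first by rewrite inE !porbit_id.
by move=> z /setIP[sz tz]; rewrite inE mem_porbitS //= eq_st // mem_porbitS.
Qed.

(* s' is s with y cut out of the cycle of x and made a fixed point. *)
Section Removal.

Variables (T : finType) (s : {perm T}) (x y : T).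
Hypotheses (sxy : s x = y) (neq_yx : y != x).

Let s' := (tperm x y * s)%g.

Lemma porbit_tperm_mul : porbit s' x = porbit s x :\ y.
Proof.
have neq_xy : x != y by rewrite eq_sym.
have s'E z : z != x -> z != y -> s' z = s z.
  by move=> zx zy; rewrite permM tpermD // eq_sym.
have s'x : s' x = s y by rewrite permM tpermL.
have s'y : s' y = y by rewrite permM tpermR.
apply/eqP; rewrite eqEsubset; apply/andP; split.
  apply: porbit_sub_stable => [|z]; first by rewrite !inE neq_xy porbit_id.
  rewrite !inE => /andP[zy sz].
  have -> /= : s' z != y by rewrite -[X in _ != X]s'y (inj_eq perm_inj).
  have [->|zx] := eqVneq z x; last by rewrite s'E // mem_porbitS.
  by rewrite s'x -sxy !mem_porbitS ?porbit_id.
rewrite subDset; apply: porbit_sub_stable => [|z].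
  by rewrite !inE porbit_id orbT.
rewrite !inE; have [->|zy /= s'z] := eqVneq z y.
  by rewrite -s'x mem_porbitS ?orbT ?porbit_id.
have [->|zx] := eqVneq z x; first by rewrite sxy eqxx.
by rewrite -s'E // mem_porbitS ?orbT.
Qed.

Lemma porbit_tperm_mul_out z : z \notin porbit s x -> porbit s' z = porbit s z.
Proof.
move=> xz; apply/esym/eq_in_porbit => t tz; rewrite permM tpermD //.
  by apply: contraNneq xz => ->; rewrite porbit_sym.
apply: contraNneq xz => yt; rewrite -yt porbit_sym in tz.
rewrite -eq_porbit_mem in tz.
by rewrite -eq_porbit_mem (eqP tz) eq_porbit_mem -sxy mem_porbitS ?porbit_id.
Qed.

End Removal.

(** * Sums over permutations weighted multiplicatively over their cycles *)

Lemma perm_on_setD1 (T : finType) (A : {set T}) (s : {perm T}) (x : T) :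
  perm_on (A :\ x) s = perm_on A s && (s x == x).
Proof.
apply/idP/andP=> [onAx | [onA /eqP sx]].
  split; last by rewrite (out_perm onAx) // !inE eqxx.
  by apply: subset_trans onAx (subsetDl _ _).
apply/subsetP=> z sz; rewrite !inE (subsetP onA z sz) andbT.
by apply: contraNneq sz => ->; rewrite sx.
Qed.

Definition cyc_wt (T : finType) (w : nat -> nat) (A : {set T}) (s : {perm T}) :=
  \prod_(C in [set porbit s z | z in A]) w #|C|.

Lemma cyc_wt_split (T : finType) w (A : {set T}) (s : {perm T}) (x : T) :
  x \in A ->
  cyc_wt w A s = w #|porbit s x| * cyc_wt w (A :\: porbit s x) s.
Proof.
move=> xA; rewrite /cyc_wt (bigD1 (porbit s x)) ?imset_f //=; congr (_ * _).
apply: eq_bigl => C; apply/andP/imsetP => [[/imsetP[z zA ->]]|[z]].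
  by rewrite eq_porbit_mem => zx; exists z; rewrite // inE zx.
by rewrite inE -eq_porbit_mem => /andP[zx zA] ->; rewrite imset_f.
Qed.

Definition sum_wt (T : finType) (w : nat -> nat) (A : {set T}) :=
  \sum_(s | perm_on A s) cyc_wt w A s.

(** The marked cycle has its own weight [u]: the recursion shifts it while [w] stays fixed, and an
    indicator of its length can be put into it. *)
Definition pointed_sum (T : finType) (u w : nat -> nat) (A : {set T}) (x : T) :=
  \sum_(s | perm_on A s) u #|porbit s x| * cyc_wt w (A :\: porbit s x) s.

Lemma sum_wt_pointed (T : finType) w (A : {set T}) (x : T) :
  x \in A -> sum_wt w A = pointed_sum w w A x.
Proof. by move=> xA; apply: eq_bigr => s _; rewrite -cyc_wt_split. Qed.

(** Split on the image [y] of [x]. If [y] is [x], the marked cycle has length 1. Otherwise, cutting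
    [y] out shortens the marked cycle by one, whence the shift of [u], and leaves the other cycles
    unchanged. *)
Lemma pointed_sum_rec (T : finType) u w (A : {set T}) (x : T) : x \in A ->
  pointed_sum u w A x = u 1 * sum_wt w (A :\ x)
    + \sum_(y in A :\ x) pointed_sum (u \o succn) w (A :\ y) x.
Proof.
move=> xA; rewrite /pointed_sum.
rewrite (partition_big (fun s : {perm T} => s x) (mem A)) /=; last first.
  by move=> s /perm_closed->.
rewrite (bigD1 x) //=; congr (_ + _).
  rewrite /sum_wt big_distrr /=; apply: eq_big => s; first by rewrite perm_on_setD1.
  by case/andP=> _ /eqP/porbit_fix->; rewrite cards1.
apply: eq_big => [y|y /andP[yA yx]]; first by rewrite !inE andbC.
(* The product [tperm x y * s] sends [y] to [s x], so it fixes [y] exactly when [s x = y]. *)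
rewrite [RHS](reindex_inj (mulgI (tperm x y))) /=.
have onA t : perm_on A (tperm x y * t)%g = perm_on A t.
  have ont : perm_on A (tperm x y).
    by apply: subset_trans (tperm_on x y) _; rewrite subUset !sub1set xA.
  apply/idP/idP => [|]; last exact: perm_onM.
  by move=> /(perm_onM ont); rewrite mulgA tperm2 mul1g.
apply: eq_big => [s|s /andP[_ /eqP sx]].
  by rewrite perm_on_setD1 onA permM tpermR.
rewrite (porbit_tperm_mul sx yx) (cardsD1 y (porbit s x)).
have -> : y \in porbit s x by rewrite -sx mem_porbitS ?porbit_id.
rewrite add1n; congr (_ * _); rewrite /cyc_wt.
have -> : (A :\ y) :\: (porbit s x :\ y) = A :\: porbit s x.
  apply/setP=> z; rewrite !inE; case: eqVneq => //= ->.
  by rewrite -sx mem_porbitS ?porbit_id.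
have eq_out : {in A :\: porbit s x, porbit s =1 porbit (tperm x y * s)%g}.
  by move=> z /setDP[_ /(porbit_tperm_mul_out sx)->].
by rewrite (eq_in_imset eq_out).
Qed.

(* Term i accounts for the marked cycles of length i + 1. *)
Definition cycle_sum (u g : nat -> nat) (N : nat) :=
  \sum_(i < N) N.-1 ^_ i * u i.+1 * g (N.-1 - i).

(** Numerical counterpart of [pointed_sum_rec], from N ^_ (i + 1) = N * (N - 1) ^_ i. *)
Lemma cycle_sumS u g N :
  cycle_sum u g N.+1 = u 1 * g N + N * cycle_sum (u \o succn) g N.
Proof.
rewrite /cycle_sum big_ord_recl /= ffactn0 mul1n subn0; congr (_ + _).
rewrite big_distrr; apply: eq_bigr => i _ /=.
by rewrite ffactnS /bump /= add1n !mulnA subnS -predn_sub.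
Qed.

(** The two recursions agree; [u] varies in the induction because each step shifts it. Only proper
    subsets enter the hypothesis, which lets [sum_wt_closed] supply it by strong induction. *)
Lemma pointed_sum_cycle (T : finType) u w g (A : {set T}) (x : T) :
  (forall B : {set T}, B \proper A -> sum_wt w B = g #|B|) ->
  x \in A -> pointed_sum u w A x = cycle_sum u g #|A|.
Proof.
move cardA: #|A| => N; elim: N A cardA u => [|N IHN] A cardA u sumA xA.
  by rewrite (cards0_eq cardA) inE in xA.
have cardD y : y \in A -> #|A :\ y| = N.
  by move=> yA; apply/eqP; rewrite -eqSS -cardA (cardsD1 y A) yA.
rewrite pointed_sum_rec // cycle_sumS sumA ?properD1 // cardD //; congr (_ + _).
rewrite -{1}(cardD x xA) -sum_nat_const; apply: eq_bigr => y /setD1P[yx yA].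
apply: IHN; rewrite ?cardD // ?inE 1?eq_sym ?yx // => B subB.
by apply: sumA; apply: proper_trans subB _; apply: properD1.
Qed.

(** Marking any point of a nonempty [A] expresses its weighted sum through smaller sets, and the
    recurrence assumed of [g] is the same one. *)
Lemma sum_wt_closed (T : finType) w g (A : {set T}) :
  g 0 = 1 -> (forall N, 0 < N -> cycle_sum w g N = g N) ->
  sum_wt w A = g #|A|.
Proof.
move=> g0 gS; have [n] := ubnP #|A|; elim: n A => // n IHn A leAn.
have [->|[x xA]] := set_0Vmem A.
  rewrite cards0 g0 /sum_wt (big_pred1 1%g) => [|s].
    by rewrite /cyc_wt imset0 big_set0.
  by apply/idP/eqP => [/perm_on_id->|->]; rewrite ?cards0 ?perm_on1.
rewrite (sum_wt_pointed _ xA) (@pointed_sum_cycle _ _ _ g _ _ _ xA) ?gS //.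
  by rewrite (cardsD1 x) xA.
by move=> B /proper_card ltBA; apply/IHn/(leq_trans ltBA).
Qed.

(** * Closed forms of the cycle sums for regular and singular weights *)

Definition deficient_fact (r N : nat) := \prod_(t < N) (t.+1 - (r %| t.+1)).

Lemma deficient_factS r N :
  deficient_fact r N.+1 = deficient_fact r N * (N.+1 - (r %| N.+1)).
Proof. exact: big_ord_recr. Qed.

(** No multiple of [r] lies among the last [d] factors, so none of them is diminished. *)
Lemma deficient_fact_ffact r q d : d < r ->
  deficient_fact r (q * r + d) = (q * r + d) ^_ d * deficient_fact r (q * r).
Proof.
elim: d => [|d IHd] ltdr; first by rewrite addn0 ffactn0 mul1n.
rewrite addnS deficient_factS IHd 1?ltnW // ffactSS -addnS.
by rewrite dvdn_addr ?dvdn_mull // gtnNdvd // subn0 mulnC mulnA.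
Qed.

Lemma ffactnD n m p : n ^_ (m + p) = n ^_ m * (n - m) ^_ p.
Proof.
elim: p => [|p IHp]; first by rewrite addn0 ffactn0 muln1.
by rewrite addnS !ffactnSr IHp subnDA mulnA.
Qed.

(* The weights are shifted by j to make the induction go through: cycle_sumS
   turns the shift j into j + 1. *)
Lemma cycle_sum_regular_shift r N j : 1 < r ->
  cycle_sum (fun l => ~~ (r %| l + j)) (deficient_fact r) N.+1
  = deficient_fact r N
    * (N.+1 - ((r %| N.+1) || ((N.+1 + j) %% r < N.+1 %% r))).
Proof.
move=> r_gt1; have r_gt0 := ltnW r_gt1.
elim: N j => [|N IHN] j.
  rewrite cycle_sumS mul0n addn0 /deficient_fact big_ord0 muln1 mul1n.
  rewrite (modn_small r_gt1) (gtnNdvd _ r_gt1) // ltnS leqn0 -/(_ %| _).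
  by case: (_ %| _).
rewrite cycle_sumS add1n.
have -> : cycle_sum ((fun l => nat_of_bool (~~ (r %| l + j))) \o succn)
    (deficient_fact r) N.+1
  = cycle_sum (fun l => ~~ (r %| l + j.+1)) (deficient_fact r) N.+1.
  by apply: eq_bigr => i _; rewrite /= addnS.
rewrite IHN deficient_factS !addSn !addnS.
set e := N.+1 %% r; set q := (N + j).+2 %% r.
(* The residues [q] and [e] differ by the shift [j.+1] modulo [r]. All the indicators thus become
   comparisons of [q] with [e]. *)
have -> : (r %| j.+1) = (q == e).
  by rewrite /q /e -addnS -addSn -{2}[N.+1]addn0 eqn_modDl mod0n.
have q_lt : q < r by rewrite ltn_mod.
have e_lt : e < r by rewrite ltn_mod.
rewrite [N.+2 %% r]modnS -/e.
have dvdN : (r %| N.+1) = (e == 0) by [].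
have dvdN2 : r %| N.+2 -> e.+1 = r.
  move=> d; apply/eqP; rewrite eqn_leq e_lt /=; apply: dvdn_leq => //.
  by rewrite /dvdn -addn1 modnDml addn1.
rewrite dvdN; have [e0|_] := eqVneq e 0.
  have -> : r %| N.+2 = false by apply/negP => /dvdN2; rewrite e0; lia.
  rewrite e0 /= ltnS leqn0 -mulnDl mulnC; congr (_ * _).
  by case: (q == 0) => /=; lia.
rewrite subn0 /= [N.+1 * (_ * _)]mulnA [N.+1 * _]mulnC [X in X + _]mulnC -mulnDr.
congr (_ * _).
(* The disjoint conditions q = e and q < e add up to q < e + 1. If [r] divides [N.+2], then e = r -
   1 and exactly one of them holds. *)
case: (boolP (r %| N.+2)) => [/dvdN2 er|_] /=; last by case: (ltngtP q e); lia.
by have := q_lt; rewrite -er ltnS; case: (ltngtP q e); lia.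
Qed.

Lemma cycle_sum_regular r N : 1 < r -> 0 < N ->
  cycle_sum (fun l => ~~ (r %| l)) (deficient_fact r) N = deficient_fact r N.
Proof.
case: N => // N r_gt1 _; have := cycle_sum_regular_shift N 0 r_gt1.
rewrite addn0 ltnn orbF -deficient_factS => <-.
by apply: eq_bigr => i _; rewrite addn0.
Qed.

Lemma dvdn_div_pred r M : r %| M.+1 -> M %/ r * r + r.-1 = M.
Proof.
case: r => [|r] // /dvdnP[[|q] // /eqP]; rewrite mulSn addSn eqSS => /eqP ->.
by rewrite [r + _]addnC divnMDl // divn_small // addn0.
Qed.

(** A nonzero term needs l + j and N + 1 - l both divisible by [r], hence also N + 1 + j. The last
    factor is the least integer at least [N] congruent to -1 modulo [r]; it is [N] itself when [r]
    divides [N.+1]. *)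
Lemma cycle_sum_singular_shift r N j : 1 < r ->
  cycle_sum (fun l => r.-1 * (r %| l + j))
    (fun l => (r %| l) * deficient_fact r l) N.+1
  = (r %| N.+1 + j) * (deficient_fact r N * (N %/ r * r + r.-1)).
Proof.
move=> r_gt1; elim: N j => [|N IHN] j.
  by rewrite cycle_sumS mul0n addn0 /deficient_fact big_ord0 dvdn0 div0n; lia.
rewrite cycle_sumS add1n.
have -> : cycle_sum ((fun l => r.-1 * (r %| l + j)) \o succn)
    (fun l => (r %| l) * deficient_fact r l) N.+1
  = cycle_sum (fun l => r.-1 * (r %| l + j.+1))
    (fun l => (r %| l) * deficient_fact r l) N.+1.
  by apply: eq_bigr => i _; rewrite /= addnS.
rewrite IHN deficient_factS !addSnnS addnS divnS //; last exact: ltnW.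
(* The first term of the recursion survives only when [r] divides [N.+1], which is also when the
   quotient by [r] increases. *)
case: (boolP (r %| N.+1)) => [dvdN|_] /=.
  rewrite dvdn_div_pred // mulnDl mul1n -addnS -addSnnS dvdn_addr //.
  have := dvdn_div_pred dvdN; nia.
by nia.
Qed.

Lemma cycle_sum_singular r N : 1 < r -> 0 < N ->
  cycle_sum (fun l => r.-1 * (r %| l))
    (fun l => (r %| l) * deficient_fact r l) N = (r %| N) * deficient_fact r N.
Proof.
case: N => // N r_gt1 _; have := cycle_sum_singular_shift N 0 r_gt1.
rewrite addn0 deficient_factS.
under [cycle_sum _ _ _]eq_bigr do rewrite addn0.
rewrite /cycle_sum => ->; case: (boolP (r %| _)) => // dvdN.
by rewrite dvdn_div_pred // subn1.
Qed.

(** The lengths rk + 1, ..., rk + r are those with [l.-1 %/ r] equal to [k]. The first r - 1 of them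
    contribute equally on the left, and the last one, with its r - 1 colors, matches their total on
    the right. *)
Lemma cycle_sum_fiber (r n k : nat) : 1 < r ->
  cycle_sum (fun l => (l.-1 %/ r == k) * ~~ (r %| l)) (deficient_fact r) (r * n)
  = cycle_sum (fun l => (l.-1 %/ r == k) * (r.-1 * (r %| l)))
      (fun l => (r %| l) * deficient_fact r l) (r * n).
Proof.
case: r => // p; set r := p.+1 => r_gt1.
rewrite /cycle_sum mulnC; set N := n * r.
pose F1 i := N.-1 ^_ i * ((i %/ r == k) * ~~ (r %| i.+1))
  * deficient_fact r (N.-1 - i).
pose F2 i := N.-1 ^_ i * ((i %/ r == k) * (p * (r %| i.+1)))
  * ((r %| N.-1 - i) * deficient_fact r (N.-1 - i)).
(* Both sums are cut into [n] blocks of [r] consecutive indices e + mr, an index being the length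
   minus one. *)
rewrite -(big_mkord xpredT F1) -(big_mkord xpredT F2) !big_nat_mul.
apply: eq_big_nat => m /= lt_mn; rewrite -[m * r]add0n mulSn !big_addn !addnK.
have divE e : e < r -> (e + m * r) %/ r = m.
  by move=> lt_er; rewrite addnC divnMDl // divn_small // addn0.
have dvdE e : r %| (e + m * r).+1 = (r %| e.+1).
  by rewrite -addSn dvdn_addl // dvdn_mull.
have subE e : e <= p -> N.-1 - (e + m * r) = (n - m.+1) * r + (p - e).
  move=> le_ep; rewrite mulnBl mulSn /N.
  have : m.+1 * r <= n * r by rewrite leq_mul2r.
  rewrite mulSn /r; lia.
rewrite !big_mkord !big_ord_recr /= {2}/F1 {1}/F2 !dvdE dvdnn.
rewrite [X in _ = X + _]big1 => [|e _]; last first.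
  by rewrite /F2 dvdE gtnNdvd ?ltnS // !muln0.
rewrite !muln0 addn0 add0n /F2 divE // dvdE dvdnn subE // subnn addn0 dvdn_mull //.
rewrite muln1 mul1n.
(* The p - e remaining points beyond a multiple of [r] give a falling factorial that completes the
   first one, so the summand no longer depends on [e]. *)
transitivity (\sum_(e < p)
    N.-1 ^_ (p + m * r) * (m == k) * deficient_fact r ((n - m.+1) * r)).
  apply: eq_bigr => e _; have le_ep : e <= p := ltnW (ltn_ord e).
  rewrite /F1 divE ?ltnS // dvdE gtnNdvd ?ltnS // muln1 subE //.
  rewrite deficient_fact_ffact ?ltnS ?leq_subr // -subE //.
  have -> : p + m * r = (e + m * r) + (p - e) by lia.
  by rewrite (ffactnD _ (e + m * r)) -!mulnA; congr (_ * _); rewrite mulnCA.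
by rewrite sum_nat_const card_ord; lia.
Qed.

(** * From weighted sums to cardinalities of fibers *)

Lemma prod_nat_of_bool (I : finType) (X P : pred I) :
  \prod_(i in X) nat_of_bool (P i) = [forall i in X, P i].
Proof.
case: (boolP [forall i in X, P i]) => [/forall_inP PX|].
  by rewrite big1 // => i /PX->.
rewrite negb_forall_in => /exists_inP[i iX /negbTE nPi].
by rewrite (bigD1 i) //= nPi.
Qed.

Section FiberSums.

Variables (r n : nat) (x : 'I_(r * n)) (k : nat).
Hypothesis r_gt1 : 1 < r.

Lemma pointed_sum_setT (w : nat -> nat) :
  pointed_sum (fun l => (l.-1 %/ r == k) * w l) w [set: 'I_(r * n)] x
  = \sum_(s : 'S_(r * n))
      (#|porbit s x|.-1 %/ r == k) * \prod_(C in porbits s) w #|C|.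
Proof.
apply: eq_big => s; first by apply/subsetP.
rewrite -mulnA -cyc_wt_split ?inE // => _; congr (_ * _).
apply: eq_bigl => C.
by apply/imsetP/imsetP => -[z _ ->]; exists z.
Qed.

(** Multiplied over all cycles, the weight [r does not divide l] is the indicator of regular
    permutations, and (r - 1)[r | l] counts the colorings of an r-cycle permutation. *)
Lemma fiber_sums :
  \sum_(s : 'S_(r * n) | perm_regular r s) (#|porbit s x|.-1 %/ r == k)
  = \sum_(s : 'S_(r * n) | rcycle_perm r s)
      (#|porbit s x|.-1 %/ r == k) * r.-1 ^ #|porbits s|.
Proof.
have xT : x \in [set: 'I_(r * n)] by rewrite inE.
have D0 : deficient_fact r 0 = 1 by rewrite /deficient_fact big_ord0.
pose wreg l := nat_of_bool (~~ (r %| l)); pose wsing l := r.-1 * (r %| l).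
have reg := @pointed_sum_cycle _ (fun l => (l.-1 %/ r == k) * wreg l) wreg _ _ x
  (fun B _ => sum_wt_closed B D0 (fun N => cycle_sum_regular r_gt1)) xT.
have D0' : (r %| 0) * deficient_fact r 0 = 1 by rewrite dvdn0 D0.
have sing := @pointed_sum_cycle _ (fun l => (l.-1 %/ r == k) * wsing l) wsing
  (fun l => (r %| l) * deficient_fact r l) _ x
  (fun B _ => sum_wt_closed B D0' (fun N => cycle_sum_singular r_gt1)) xT.
have := cycle_sum_fiber n k r_gt1.
rewrite cardsT card_ord in reg sing.
rewrite -reg -sing !pointed_sum_setT => eq_sum.
rewrite big_mkcond [in RHS]big_mkcond /=.
transitivity (\sum_(s : 'S_(r * n))
  (#|porbit s x|.-1 %/ r == k) * \prod_(C in porbits s) wreg #|C|).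
  apply: eq_bigr => s _; rewrite (prod_nat_of_bool (mem (porbits s))).
  by rewrite -/(perm_regular r s); case: ifP; rewrite ?muln1 ?muln0.
rewrite eq_sum; apply: eq_bigr => s _; rewrite big_split /= prod_nat_const.
rewrite (prod_nat_of_bool (mem (porbits s))) -/(rcycle_perm r s).
by case: ifP; rewrite ?muln1 ?muln0.
Qed.

End FiberSums.

Lemma card_color r : #|{: color r}| = r.-1.
Proof.
rewrite card_sig; case: r => [|r]; first by rewrite eq_card0 // => -[].
rewrite -[in RHS](card_ord r.+1) -(cardC1 ord0) /=.
by apply: eq_card => i; rewrite !inE lt0n.
Qed.

Lemma card_singular_cycles r N (s : 'S_N) : rcycle_perm r s ->
  #|{: singular_cycles r s}| = #|porbits s|.
Proof.
move=> /forall_inP sing; rewrite card_sig; apply: eq_card => C.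
by rewrite !inE; case: (boolP (C \in _)) => // /sing.
Qed.

Lemma card_sig_pred (T : finType) (Q P : pred T) :
  #|[pred e : {x | Q x} | P (val e)]| = #|[pred x | Q x && P x]|.
Proof.
rewrite -(card_image val_inj); apply: eq_card => x; rewrite inE /=.
apply/imageP/andP => [[e Pe ->]|[Qx Px]]; first by split=> //; apply: valP.
by exists (Sub x Qx); rewrite ?inE ?SubK.
Qed.

Lemma card_Reg_fiber r N (P : pred 'S_N) :
  #|[pred e : Reg r N | P (val e)]| = \sum_(s : 'S_N | perm_regular r s) P s.
Proof.
rewrite (card_sig_pred (fun s : 'S_N => perm_regular r s) P).
by rewrite -sum1_card big_mkcondr; apply: eq_bigr => s _; case: (P s).
Qed.

Lemma card_CycStar_fiber r N (P : pred 'S_N) :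
  #|[pred e : CycStar r N | P (underlying (val e))]|
  = \sum_(s : 'S_N | rcycle_perm r s) P s * r.-1 ^ #|porbits s|.
Proof.
rewrite (card_sig_pred (fun e : enriched r N => rcycle_perm r (underlying e))
  (fun e => P (underlying e))).
rewrite -sum1_card.
transitivity (\sum_(s : 'S_N | rcycle_perm r s && P s)
    \sum_(c : {ffun singular_cycles r s -> color r}) 1).
  by rewrite sig_big_dep; apply: eq_bigl => e; rewrite andbT.
rewrite big_mkcondr; apply: eq_bigr => s sing; case: (P s); rewrite ?mul0n //.
by rewrite sum1_card card_ffun card_color card_singular_cycles // mul1n.
Qed.

(** * A bijection from equal fiber cardinalities *)

Lemma fiberwise_injection (X Y : finType) (f : X -> nat) (g : Y -> nat) :
  (forall k, #|[pred x | f x == k]| = #|[pred y | g y == k]|) ->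
  exists2 h : X -> Y, injective h & forall x, g (h x) = f x.
Proof.
move=> card_fg.
have idx_lt x : index x (enum [pred x' | f x' == f x])
    < size (enum [pred y | g y == f x]).
  by rewrite -cardE -card_fg cardE index_mem mem_enum inE /=.
(* A point goes to the one of equal rank in the enumeration of the corresponding fiber of [g]. *)
pose h x := tnth (in_tuple (enum [pred y | g y == f x])) (Ordinal (idx_lt x)).
have gh x : g (h x) = f x.
  have : h x \in enum [pred y | g y == f x] by apply: mem_tnth.
  by rewrite mem_enum => /eqP.
exists h => // x x' eq_h.
have eq_f : f x = f x' by rewrite -!gh eq_h.
have lt_x' := idx_lt x'; move: eq_h lt_x'; rewrite /h !(tnth_nth (h x)) /= -eq_f.
move=> /eqP eq_h lt_x'; move: eq_h; rewrite nth_uniq ?enum_uniq // => /eqP.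
move/(congr1 (nth x (enum [pred z | f z == f x]))).
by rewrite !nth_index ?mem_enum ?inE //= eq_f.
Qed.

(** The injection in the other direction serves only to compare cardinalities, which makes [h]
    bijective. *)
Lemma fiberwise_bijection (X Y : finType) (f : X -> nat) (g : Y -> nat) :
  (forall k, #|[pred x | f x == k]| = #|[pred y | g y == k]|) ->
  exists2 h : X -> Y, bijective h & forall x, g (h x) = f x.
Proof.
move=> card_fg; have [h inj_h gh] := fiberwise_injection card_fg.
have [h' inj_h' _] := fiberwise_injection (fun k => esym (card_fg k)).
by exists h => //; apply: inj_card_bij inj_h (leq_card h' inj_h').
Qed.

Theorem theorem2p1 (r n : nat) (hr : 1 < r) (hn : 0 < n) :
  exists Phi : Reg r (r * n) -> CycStar r (r * n),
    bijective Phi /\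
    forall (sigma : Reg r (r * n)) (k i : nat),
      0 < i < r ->
      #|porbit (val sigma) (elt1 hr hn)| = r * k + i ->
      #|porbit (underlying (sval (Phi sigma))) (elt1 hr hn)| = r * k + r.
Proof.
pose x := elt1 hr hn.
(* Subtracting one before dividing puts the length rk + r in the same class as rk + 1, ..., rk + r -
   1. *)
pose q (s : 'S_(r * n)) := #|porbit s x|.-1 %/ r.
have [k|Phi bijPhi qPhi] := @fiberwise_bijection (Reg r (r * n))
  (CycStar r (r * n)) (fun e => q (val e)) (fun e => q (underlying (val e))).
  rewrite (card_Reg_fiber r (fun s => q s == k)).
  by rewrite (card_CycStar_fiber r (fun s => q s == k)) (fiber_sums x k hr).
exists Phi; split=> // sigma k i /andP[i_gt0 lt_ir] sigma1.
have : rcycle_perm r (underlying (sval (Phi sigma))) by case: (Phi sigma).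
have : q (underlying (sval (Phi sigma))) = q (val sigma) by apply: qPhi.
move: (underlying _) => t; rewrite /q sigma1 -/x => q_t /forall_inP sing.
have tx : porbit t x \in porbits t by apply: imset_f.
have /dvdnP[m lenE] := sing _ tx.
have := card_porbit_neq0 t x; rewrite lenE in q_t *.
(* A cycle is nonempty, so its length is (m + 1)r, whose class is [m]; preservation of [q] then
   forces m = k. *)
case: m {lenE} q_t => [|m] // q_t _; move: q_t.
have r_gt0 : 0 < r := ltnW hr.
have -> : (m.+1 * r).-1 = m * r + r.-1 by rewrite mulSn; lia.
have -> : (r * k + i).-1 = k * r + i.-1 by rewrite mulnC; lia.
rewrite !divnMDl // !divn_small ?prednK ?ltn_predL ?(ltnW lt_ir) // ?addn0.
by move=> ->; rewrite mulSn addnC mulnC.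
Qed.
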